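(* Let $0<\varepsilon\le 1/2$ and let $f:\{0,1\}^n\to\{0,1\}$ be accessed by queries. The algorithm Union-Closed-Tester described below makes $n^{O(\sqrt{n\log(1/\varepsilon)})}/\varepsilon$ queries to $f$, and: (1) if $f$ is union-closed, it outputs ''union-closed'' with probability $1$; (2) if the distance from $f$ to union-closed functions is greater than $\varepsilon$, it outputs ''$\varepsilon$-far from union-closed'' with probability at least $9/10$.
   Context: $|x|$ denotes the number of ones of $x\in\{0,1\}^n$; identify $x$ with $\{i:x_i=1\}$, $\cup$ is coordinatewise OR, $y\le x$ is coordinatewise order. $f$ is union-closed if $f(x)=f(y)=1$ implies $f(x\cup y)=1$; distance between functions is the fraction of inputs where they differ. Let $I:=[n/2-\sqrt{2n\ln(4/\varepsilon)},\,n/2+\sqrt{2n\ln(4/\varepsilon)}]$ and let $\mathcal M=\{x\in\{0,1\}^n:|x|\in I\}$. Union-Closed-Tester: repeat $100/\varepsilon$ times: sample $\mathbf x$ uniformly from $\mathcal M$; let $\mathbf x_\downarrow=\{y\le\mathbf x: y\in\mathcal M\}$ and query $f$ on $\mathbf x$ and on every $y\in\mathbf x_\downarrow$; if there are $y_1,\dots,y_k\in\mathbf x_\downarrow$ with $f(y_1)=\dots=f(y_k)=1$, $y_1\cup\dots\cup y_k=\mathbf x$ and $f(\mathbf x)=0$, halt and output ''$\varepsilon$-far from union-closed''. If no repetition halts, output ''union-closed''. *)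

(* Defs.v *)
From HB Require Import structures.
From mathcomp Require Import all_boot all_order all_algebra.
From mathcomp Require Import all_classical all_reals all_analysis.

Set Implicit Arguments.
Unset Strict Implicit.
Unset Printing Implicit Defensive.

Import Order.TTheory GRing.Theory Num.Theory.
Local Open Scope ring_scope.

(* A point x of {0,1}^n is identified with {i | x_i = 1}, so that |x| is #|x|,
   coordinatewise OR is :|: and the coordinatewise order is \subset. *)
Notation cube n := {set 'I_n}.

Notation boolfun n := {ffun cube n -> bool}.

Definition union_closed (n : nat) (f : boolfun n) : bool :=
  [forall x, forall y, f x && f y ==> f (x :|: y)].

Definition dist (R : realType) (n : nat) (f g : boolfun n) : R :=
  #|[set x | f x != g x]|%:R / #|{: cube n}|%:R.

(* All distances are at most 1 and some function is union-closed, so the default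
   value 1 does not affect the minimum. *)
Definition dist_union_closed (R : realType) (n : nat) (f : boolfun n) : R :=
  \big[Num.min/1]_(g : boolfun n | union_closed g) dist R f g.

(* Randomized algorithms with query access to a function cube n -> bool; the
   function is visible only through the answers passed to the continuation of
   Query.  Unif X k draws x uniformly from X and continues with k x. *)
Inductive qprog (n : nat) (A : Type) : Type :=
| Ret of A
| Query of cube n & (bool -> qprog n A)
| Unif of {set cube n} & (cube n -> qprog n A).

Arguments Ret {n A}.
Arguments Query {n A}.
Arguments Unif {n A}.

Fixpoint bind (n : nat) (A B : Type) (p : qprog n A) (h : A -> qprog n B) :
    qprog n B :=
  match p with
  | Ret a => h a
  | Query x k => Query x (fun b => bind (k b) h)
  | Unif X k => Unif X (fun x => bind (k x) h)
  end.

(* The probability that p, run on f, outputs an element of E. *)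
Fixpoint prob (R : realType) (n : nat) (A : Type) (f : boolfun n)
    (p : qprog n A) (E : pred A) : R :=
  match p with
  | Ret a => (E a)%:R
  | Query x k => prob R f (k (f x)) E
  | Unif X k => (\sum_(x in X) prob R f (k x) E) / #|X|%:R
  end.

(* The largest number of queries (with repetitions) that p makes when run on f,
   over all random choices. *)
Fixpoint queries (n : nat) (A : Type) (f : boolfun n) (p : qprog n A) : nat :=
  match p with
  | Ret _ => 0%N
  | Query x k => (queries f (k (f x))).+1
  | Unif X k => \max_(x in X) queries f (k x)
  end.

Fixpoint query_ones (n : nat) (s : seq (cube n)) : qprog n (seq (cube n)) :=
  if s is y :: s' then
    Query y (fun b => bind (query_ones s')
                        (fun t => Ret (if b then y :: t else t)))
  else Ret [::].

Definition middle (R : realType) (n : nat) (eps : R) : {set cube n} :=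
  let w := Num.sqrt (2 * n%:R * ln (4 / eps)) in
  [set x : cube n | #|x|%:R \in `[n%:R / 2 - w, n%:R / 2 + w]].

Definition down_in (n : nat) (M : {set cube n}) (x : cube n) : {set cube n} :=
  [set y in M | y \subset x].

(* x = y_1 \cup ... \cup y_k for some y_1, ..., y_k in t with k >= 1; k = 0 would
   make the empty union equal to the all-zero point. *)
Definition is_union (n : nat) (t : seq (cube n)) (x : cube n) : bool :=
  [exists Y : {set cube n},
    [&& Y != finset.set0, Y \subset [set:: t] & \bigcup_(y in Y) y == x]].

Variant verdict : Type := UnionClosed | FarFromUnionClosed.

Definition bool_of_verdict (v : verdict) : bool :=
  if v is UnionClosed then true else false.
Definition verdict_of_bool (b : bool) : verdict :=
  if b then UnionClosed else FarFromUnionClosed.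
Lemma bool_of_verdictK : cancel bool_of_verdict verdict_of_bool.
Proof. by case. Qed.
HB.instance Definition _ := Equality.copy verdict (can_type bool_of_verdictK).

Fixpoint rounds (n : nat) (M : {set cube n}) (m : nat) : qprog n verdict :=
  if m is m'.+1 then
    Unif M (fun x => Query x (fun fx =>
      bind (query_ones (enum (down_in M x))) (fun t =>
        if ~~ fx && is_union t x then Ret FarFromUnionClosed
        else rounds M m')))
  else Ret UnionClosed.

Definition union_closed_tester (R : realType) (n : nat) (eps : R) :
    qprog n verdict :=
  rounds (middle n eps) `|Num.ceil (100 / eps)|%N.

(* Main.v *)
Require Import Defs.
From mathcomp Require Import all_boot all_order all_algebra.
From mathcomp Require Import all_classical all_reals all_analysis.
From mathcomp Require Import ring lra.
From mathcomp Require Import finset.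

Set Implicit Arguments.
Unset Strict Implicit.
Unset Printing Implicit Defensive.

Import Order.TTheory GRing.Theory Num.Theory.
Local Open Scope ring_scope.

(* Let M be the set of middle layers.  Call x in M rejecting if f x = 0 although
   x is a union of points of M at which f is 1; a round detects a violation
   exactly when it samples a rejecting point, so the verdict after m rounds is
   governed by (1 - p)^m, with p the density of rejecting points in M.  The
   function that is 1 above M, 0 below M, and on M takes the union closure of f
   is union-closed and differs from f only at rejecting points and outside M.
   A Chernoff bound shows that the complement of M has density at most eps / 2,
   so if f is eps-far then p >= eps / 2, and (1 - p)^m <= 1 / (1 + m p) with
   m >= 100 / eps concludes.  For the query bound, a point of M below x is
   obtained from x by deleting at most the width of M many coordinates. *)

(** * Evaluation of query programs on a fixed [f] *)

Lemma bindA (n : nat) (A B D : Type) (p : qprog n A) (g : A -> qprog n B)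
    (h : B -> qprog n D) :
  bind (bind p g) h = bind p (fun a => bind (g a) h).
Proof.
elim: p => [a|x k IH|X k IH] //=.
  by congr (Query x); apply/funext => b; apply: IH.
by congr (Unif X); apply/funext => b; apply: IH.
Qed.

Lemma prob_bind_query_ones (R : realType) (n : nat) (A : Type) (f : boolfun n)
    (s : seq (cube n)) (h : seq (cube n) -> qprog n A) (E : pred A) :
  prob R f (bind (query_ones s) h) E = prob R f (h [seq y <- s | f y]) E.
Proof.
by elim: s h => [|y s IH] h //=; rewrite bindA IH /=; case: (f y).
Qed.

Lemma queries_bind_query_ones (n : nat) (A : Type) (f : boolfun n)
    (s : seq (cube n)) (h : seq (cube n) -> qprog n A) :
  queries f (bind (query_ones s) h)
    = (size s + queries f (h [seq y <- s | f y]))%N.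
Proof.
by elim: s h => [|y s IH] h //=; rewrite bindA IH /=; case: (f y).
Qed.

(** * Unions of ones of [f] inside [M] *)

Definition below_union (n : nat) (f : boolfun n) (M : {set cube n})
    (x : cube n) : bool :=
  is_union [seq y <- enum (down_in M x) | f y] x.

Definition rejecting (n : nat) (f : boolfun n) (M : {set cube n}) :
    {set cube n} :=
  [set x in M | ~~ f x && below_union f M x].

(** No clause [y \subset x] is kept: it follows from the union being [x]. *)
Lemma below_unionP (n : nat) (f : boolfun n) (M : {set cube n}) (x : cube n) :
  reflect (exists Y : {set cube n},
             [/\ Y != set0, forall y, y \in Y -> (y \in M) && f y
               & \bigcup_(y in Y) y = x])
          (below_union f M x).
Proof.
apply: (iffP existsP) => -[Y].
  case/and3P=> Y0 /fintype.subsetP YM /eqP Yx; exists Y; split=> // y /YM.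
  by rewrite inE mem_filter mem_enum inE => /and3P[-> ->].
case=> Y0 YM Yx; exists Y; rewrite Y0 Yx eqxx andbT /=.
apply/fintype.subsetP => y Yy; rewrite inE mem_filter mem_enum inE -Yx.
by have /andP[-> ->] := YM _ Yy; rewrite bigcup_sup.
Qed.

Lemma below_union_self (n : nat) (f : boolfun n) (M : {set cube n})
    (x : cube n) :
  x \in M -> f x -> below_union f M x.
Proof.
move=> Mx fx; apply/below_unionP; exists [set x]; split.
- by apply/set0Pn; exists x; rewrite inE.
- by move=> y /set1P ->; rewrite Mx.
- by rewrite big_set1.
Qed.

Lemma below_unionU (n : nat) (f : boolfun n) (M : {set cube n})
    (x y : cube n) :
  below_union f M x -> below_union f M y -> below_union f M (x :|: y).
Proof.
move=> /below_unionP[X [X0 XM <-]] /below_unionP[Y [Y0 YM <-]].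
apply/below_unionP; exists (X :|: Y); split.
- by rewrite setU_eq0 negb_and X0.
- by move=> z /setUP[/XM|/YM].
- by rewrite bigcup_setU.
Qed.

Lemma union_closed_below_union (n : nat) (f : boolfun n) (M : {set cube n})
    (x : cube n) :
  union_closed f -> below_union f M x -> f x.
Proof.
move=> /forallP fU /below_unionP[Y [Y0 YM <-]].
have fY : {in enum Y, forall y, f y}.
  by move=> y; rewrite mem_enum => /YM /andP[].
have : enum Y != [::] by rewrite -size_eq0 -cardE cards_eq0.
rewrite -big_enum; elim: (enum Y) fY => [//|y s IH] fs _.
have fy : f y by apply: fs; rewrite mem_head.
(* An empty tail is split off: its union is the empty set, where [f] may be 0. *)
rewrite big_cons; have [->|s0] := eqVneq s [::].
  by rewrite big_nil /= setU0.
have /forallP/(_ (\bigcup_(z <- s) z))/implyP := fU y; apply.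
by rewrite fy IH // => z zs; apply: fs; rewrite inE zs orbT.
Qed.

Lemma union_closed_rejecting (n : nat) (f : boolfun n) (M : {set cube n}) :
  union_closed f -> rejecting f M = set0.
Proof.
move=> fU; apply/setP => x; rewrite !inE; apply/negP => /and3P[_ /negP nfx].
by move/(union_closed_below_union fU).
Qed.

(** * Verdict and query count of [m] rounds *)

Lemma prob_rounds (R : realType) (n : nat) (f : boolfun n) (M : {set cube n})
    (m : nat) (E : pred verdict) :
  M != set0 ->
  let q : R := (1 - #|rejecting f M|%:R / #|M|%:R) ^+ m in
  prob R f (rounds M m) E
    = (1 - q) * (E FarFromUnionClosed)%:R + q * (E UnionClosed)%:R.
Proof.
move=> M0 /=.
have cM : (#|M|%:R : R) != 0 by rewrite pnatr_eq0 cards_eq0.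
elim: m => [|m IH] /=; first by rewrite expr0; lra.
set p := _ / _ in IH *; set e := (E FarFromUnionClosed)%:R in IH *.
set u := (E UnionClosed)%:R in IH *.
set v := prob R f (rounds M m) E in IH *.
(* Given [x], the outcome is [e] at a rejecting point and [v] otherwise. Writing this as affine in
   the indicator lets the sum over [M] split. *)
under eq_bigr => x Mx.
  have -> : prob R f (bind (query_ones (enum (down_in M x)))
        (fun t => if ~~ f x && is_union t x then Ret FarFromUnionClosed
                  else rounds M m)) E
      = v + (x \in rejecting f M)%:R * (e - v).
    rewrite prob_bind_query_ones -/(below_union f M x) inE Mx /=.
    by case: ifP => _ /=; rewrite ?mul1r ?mul0r ?addr0 // addrC subrK.
  over.
rewrite big_split /= sumr_const -mulr_suml.
have -> : \sum_(x in M) (x \in rejecting f M)%:R = #|rejecting f M|%:R :> R.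
  rewrite -natr_sum; congr _%:R; rewrite -sum1_card.
  rewrite big_mkcond [RHS]big_mkcond /=.
  by apply: eq_bigr => x _; rewrite !inE; case: (x \in M); case: (~~ _ && _).
rewrite -[v *+ _]mulr_natr mulrDl mulfK // mulrAC -/p IH exprS.
ring.
Qed.

(** The successor in [d.+1] pays for the query at the sampled point itself. *)
Lemma queries_rounds (n : nat) (f : boolfun n) (M : {set cube n}) (m d : nat) :
  (forall x, x \in M -> (#|down_in M x| <= d)%N) ->
  (queries f (rounds M m) <= m * d.+1)%N.
Proof.
move=> Md; elim: m => [|m IH] //=.
apply/bigmax_leqP => x Mx; rewrite queries_bind_query_ones -cardE mulSn addSn.
rewrite ltnS leq_add ?Md //.
by case: ifP.
Qed.

(** * Counting the points of [M] below a point *)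

Lemma card_small_sets (T : finType) (k : nat) :
  (#|[set y : {set T} | (#|y| <= k)%N]| <= #|T|.+1 ^ k)%N.
Proof.
(* Padding with [None] lets tuples of fixed length [k] cover all sets of at most [k] elements. *)
pose g (t : k.-tuple (option T)) := [set x | Some x \in val t].
rewrite -card_option -card_tuple.
apply: leq_trans (leq_image_card g predT); apply: subset_leq_card.
apply/fintype.subsetP => y; rewrite inE => yk.
pose s := [seq Some x | x <- enum y] ++ nseq (k - #|y|) None.
have sk : size s == k by rewrite size_cat size_map size_nseq -cardE subnKC.
apply/fintype.imageP; exists (Tuple sk) => //; apply/setP => x.
rewrite inE /= mem_cat mem_nseq andbF orbF mem_map ?mem_enum // => ? ? [].
Qed.

(** A point [y] below [x] is determined by the deleted set [x :\: y], which has at most [k]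
    elements. *)
Lemma card_down_in (n k : nat) (M : {set cube n}) (x : cube n) :
  (forall y, y \in M -> (#|x| - #|y| <= k)%N) ->
  (#|down_in M x| <= n.+1 ^ k)%N.
Proof.
move=> Mk; rewrite -[n in n.+1]card_ord; apply: leq_trans (card_small_sets _ k).
rewrite -(card_in_imset (f := fun y => x :\: y)); last first.
  have xDD (u : cube n) : u \subset x -> x :\: (x :\: u) = u.
    by move=> ux; rewrite setDDr setDv set0U (setIidPr ux).
  move=> y z; rewrite !inE => /andP[_ yx] /andP[_ zx] yz.
  by rewrite -(xDD y) // yz xDD.
apply: subset_leq_card; apply/fintype.subsetP => _ /imsetP[y + ->].
rewrite !inE => /andP[My yx].
by rewrite cardsD (setIidPr yx) Mk.
Qed.

(** * Distance to union-closed functions *)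

Lemma card_cube (n : nat) : #|{: cube n}| = (2 ^ n)%N.
Proof. by rewrite -cardsT -powersetT card_powerset cardsT card_ord. Qed.

Lemma mem_layers (R : realType) (n : nat) (a b : R) (x : cube n) :
  (x \in [set y : cube n | #|y|%:R \in `[a, b]]) = (a <= #|x|%:R <= b).
Proof. by rewrite inE in_itv. Qed.

Lemma far_many_rejecting (R : realType) (n : nat) (f : boolfun n)
    (a b eps : R) (M := [set x : cube n | #|x|%:R \in `[a, b]]) :
  eps < dist_union_closed R f ->
  eps * 2 ^+ n < #|rejecting f M|%:R + #|~: M|%:R.
Proof.
move=> far.
pose g : boolfun n :=
  [ffun x : cube n => (b < #|x|%:R) || (x \in M) && below_union f M x].
have gU : union_closed g.
  apply/'forall_forallP => x y; rewrite !ffunE; apply/implyP => /andP[gx gy].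
  have xz : #|x|%:R <= #|x :|: y|%:R :> R.
    by rewrite ler_nat subset_leq_card ?subsetUl.
  have yz : #|y|%:R <= #|x :|: y|%:R :> R.
    by rewrite ler_nat subset_leq_card ?subsetUr.
  (* If the union is not above [M], neither are [x] and [y], so both lie in [M]. The union is then
     in [M] too, its size being between [#|x|] and [b]. *)
  case: ltP => //= zb; move: gx gy.
  rewrite !ltNge (le_trans xz zb) (le_trans yz zb) /=.
  case/andP=> xM xU /andP[yM yU]; rewrite below_unionU // andbT.
  by move: xM; rewrite !mem_layers /= zb andbT => /andP[/le_trans->].
have far_g : eps < dist R f g := lt_le_trans far (bigmin_le_cond _ _ gU).
have n2 : 0 < 2 ^+ n :> R by rewrite exprn_gt0.
have cardE : #|{: cube n}|%:R = 2 ^+ n :> R.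
  by rewrite card_cube natrX.
move: far_g; rewrite /dist cardE ltr_pdivlMr // => /lt_le_trans; apply.
rewrite -natrD ler_nat; apply: leq_trans (leq_card_setU _ _).
apply: subset_leq_card; apply/fintype.subsetP => x; rewrite in_setU in_setC inE.
(* On [M], [f x] implies [g x], so [f] and [g] can only differ there at a rejecting point. *)
case: (boolP (x \in M)) => [xM|]; last by rewrite orbT.
have /andP[_ /le_gtF xb] : a <= #|x|%:R <= b by rewrite -mem_layers.
rewrite ffunE xb xM orbF [x \in rejecting f M]inE xM /= => fx.
case: (boolP (f x)) fx => [/(below_union_self xM) ->|] //=.
by case: below_union.
Qed.

(** * Chernoff bound for the middle layers *)

Lemma expR_symm_le (R : realType) (t : R) :
  0 <= t -> t <= 1 / 2 -> expR t + expR (- t) <= 2 * expR (3 / 2 * t ^+ 2).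
Proof.
move=> t0 t1.
have et : expR t <= (1 - t)^-1.
  rewrite -[t in leLHS]opprK expRN lef_pV2 ?posrE ?expR_gt0; [|lra..].
  exact: expR_ge1Dx.
have eNt : expR (- t) <= (1 + t)^-1.
  by rewrite expRN lef_pV2 ?posrE ?expR_gt0 ?expR_ge1Dx; lra.
have e32 := expR_ge1Dx (3 / 2 * t ^+ 2).
(* The left side is [2 / (1 - t ^+ 2)], and [(1 - u) * (1 + 3 / 2 * u) >= 1] for
   [0 <= u <= 1 / 4]. *)
suff : (1 - t)^-1 + (1 + t)^-1 <= 2 * (1 + 3 / 2 * t ^+ 2) by lra.
have -> : (1 - t)^-1 + (1 + t)^-1 = 2 / (1 - t ^+ 2).
  by field; apply/and3P; split; nra.
have : 0 <= t ^+ 2 <= 1 / 4 by rewrite sqr_ge0; nra.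
by move: (t ^+ 2) => u /andP[u0 u1]; rewrite ler_pdivrMr; nra.
Qed.

(** [2 * #|x| - n] is a sum of [n] signs, so the exponential factors over coordinates; expanding the
    power, [x] collects the coordinates that choose [expR t]. *)
Lemma sum_expR_card (R : realType) (n : nat) (t : R) :
  \sum_(x : cube n) expR (t * (2 * #|x|%:R - n%:R))
    = (expR t + expR (- t)) ^+ n.
Proof.
rewrite -[in RHS](card_ord n) -prodr_const (bigA_distr 1 +%R) /=.
apply: eq_big => [x|x _]; first by rewrite inE.
rewrite (bigID [in x]) /= (eq_bigr (fun=> expR t)) => [|i ->//].
rewrite [X in _ = _ * X](eq_bigr (fun=> expR (- t))) => [|i /negbTE ->//].
rewrite prodr_const (eq_bigl [in ~: x]) => [|i]; last by rewrite !inE.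
rewrite prodr_const -!expRM_natl -expRD; congr (expR _).
have : #|x|%:R + #|~: x|%:R = n%:R :> R by rewrite -natrD cardsC card_ord.
by move=> <-; ring.
Qed.

Lemma card_middleC (R : realType) (n : nat) (w l : R) :
  0 <= w -> 2 * n%:R * l <= w ^+ 2 ->
  #|~: [set x : cube n | #|x|%:R \in `[n%:R / 2 - w, n%:R / 2 + w]]|%:R
    <= 2 * expR (- l) * 2 ^+ n.
Proof.
(* For [w >= n / 2] every layer is kept, which covers [n = 0]; otherwise [t = w / n] is below
   [1 / 2]. *)
move=> w0 wl; set M := [set x | _].
have [nw|wn] := leP (n%:R / 2) w.
  have -> : ~: M = set0.
    apply/setP => x; rewrite in_setC mem_layers in_set0.
    have : #|x|%:R <= n%:R :> R by rewrite ler_nat -[leqRHS]card_ord max_card.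
    have := ler0n R #|x|; move=> x0 xn; apply/negbTE; rewrite negbK.
    by apply/andP; split; lra.
  by rewrite cards0 !mulr_ge0 ?expR_ge0 ?exprn_ge0.
have n0 : 0 < n%:R :> R by lra.
(* With cosh t <= exp (3/2 t^2) this makes the exponent - w^2 / (2 n) <= - l. *)
pose t := w / n%:R.
have tn : t * n%:R = w by rewrite /t mulfVK // gt_eqF.
have t0 : 0 <= t by rewrite divr_ge0 // ltW.
have t1 : t <= 1 / 2 by rewrite ler_pdivrMr //; lra.
(* [F] dominates the indicator of [~: M]: there [2 * #|x| - n] exceeds [2 * w] in absolute value, so
   one of the two exponents is nonnegative. *)
pose F (x : cube n) : R := expR (- (2 * t * w)) *
  (expR (t * (2 * #|x|%:R - n%:R)) + expR (- t * (2 * #|x|%:R - n%:R))).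
have F0 x : 0 <= F x by rewrite mulr_ge0 ?addr_ge0 ?expR_ge0.
have F1 x : x \in ~: M -> 1 <= F x.
  rewrite in_setC mem_layers negb_and -!ltNge /F mulrDr -!expRD => xM.
  have e1 (u : R) : 0 <= u -> 1 <= expR u.
    by move=> u0; apply: le_trans (expR_ge1Dx u); rewrite lerDl.
  case/orP: xM => xM.
    rewrite ler_wpDl ?expR_ge0 // e1 //; nra.
  rewrite ler_wpDr ?expR_ge0 // e1 //; nra.
have -> : #|~: M|%:R = \sum_(x in ~: M) 1 :> R by rewrite sumr_const.
apply: (@le_trans _ _ (\sum_x F x)).
  rewrite big_mkcond ler_sum // => x _; case: ifP => // xM; exact: F1.
rewrite -mulr_sumr big_split /= !sum_expR_card opprK.
rewrite [expR (- t) + _]addrC -mulr2n.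
have sn : (expR t + expR (- t)) ^+ n <= 2 ^+ n * expR (3 / 2 * t * w).
  have -> : 3 / 2 * t * w = n%:R * (3 / 2 * t ^+ 2) by rewrite -tn; ring.
  rewrite expRM_natl -exprMn.
  by rewrite lerXn2r ?nnegrE ?addr_ge0 ?mulr_ge0 ?expR_ge0 // expR_symm_le.
have tw : - (2 * t * w) + 3 / 2 * t * w <= - l.
  have tl : 2 * l <= t * w by rewrite /t mulrAC ler_pdivlMr // -expr2; lra.
  lra.
have /(ler_wpM2l (expR_ge0 (- (2 * t * w)))) := sn.
rewrite [leRHS]mulrCA -expRD => sn'.
have : 2 ^+ n * expR (- (2 * t * w) + 3 / 2 * t * w) <= 2 ^+ n * expR (- l).
  by rewrite ler_wpM2l ?exprn_ge0 // ler_expR.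
lra.
Qed.

(** * Numerical parameters of the tester *)

Lemma bernoulli_inv (R : realType) (p : R) (m : nat) :
  0 <= p -> p <= 1 -> (1 - p) ^+ m * (1 + m%:R * p) <= 1.
Proof.
move=> p0 p1; elim: m => [|m IH]; first by rewrite mul0r addr0 mulr1.
apply: le_trans IH; rewrite exprSr -mulrA ler_wpM2l ?exprn_ge0 ?subr_ge0 //.
(* This is the gap between [1 + m * p] and [(1 - p) * (1 + (m + 1) * p)]. *)
have : 0 <= (m%:R + 1) * p ^+ 2 by rewrite mulr_ge0 ?addr_ge0 ?sqr_ge0.
rewrite -natr1; lra.
Qed.

Lemma card_middle_compl (R : realType) (n : nat) (eps : R) :
  0 < eps -> eps <= 1 / 2 ->
  #|~: middle n eps|%:R <= eps / 2 * 2 ^+ n :> R.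
Proof.
move=> eps0 eps1.
pose w : R := Num.sqrt (2 * n%:R * ln (4 / eps)).
have e4 : 1 <= 4 / eps by rewrite ler_pdivlMr //; lra.
(* For [l = ln (4 / eps)] the factor [2 * expR (- l)] is [eps / 2]. *)
have := @card_middleC R n w (ln (4 / eps)) (sqrtr_ge0 _).
rewrite expRN lnK ?posrE ?divr_gt0 // invf_div sqr_sqrtr ?mulr_ge0 ?ln_ge0 //.
move=> /(_ (lexx _)) /le_trans; apply.
by rewrite ler_wpM2r ?exprn_ge0 //; lra.
Qed.

Lemma card_middle_gt0 (R : realType) (n : nat) (eps : R) :
  0 < eps -> eps <= 1 / 2 -> 0 < #|middle n eps|%:R :> R.
Proof.
move=> eps0 eps1.
have cM : #|middle n eps|%:R + #|~: middle n eps|%:R = 2 ^+ n :> R.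
  by rewrite -natrD cardsC card_cube natrX.
have n2 : 0 < 2 ^+ n :> R by rewrite exprn_gt0.
have := card_middle_compl n eps0 eps1; nra.
Qed.

Lemma middle_neq0 (R : realType) (n : nat) (eps : R) :
  0 < eps -> eps <= 1 / 2 -> middle n eps != set0.
Proof.
move=> eps0 eps1; have := card_middle_gt0 n eps0 eps1.
by rewrite ltr0n card_gt0.
Qed.

Lemma rounds_ge (R : realType) (eps : R) :
  0 < eps -> 100 / eps <= (`|Num.ceil (100 / eps)|%N)%:R.
Proof.
move=> eps0.
have h : 0 <= 100 / eps by rewrite divr_ge0 // ltW.
rewrite natr_absz ger0_norm ?ceil_ge //.
by rewrite -(ler0z R); apply: le_trans (ceil_ge _).
Qed.

(** Rounding up adds less than 1, and [1 <= 1 / eps]. *)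
Lemma rounds_le (R : realType) (eps : R) :
  0 < eps -> eps <= 1 / 2 -> (`|Num.ceil (100 / eps)|%N)%:R <= 101 / eps.
Proof.
move=> eps0 eps1.
have h : 0 <= 100 / eps by rewrite divr_ge0 // ltW.
have c0 : 0 <= Num.ceil (100 / eps).
  by rewrite -(ler0z R); apply: le_trans (ceil_ge _).
rewrite natr_absz ger0_norm //.
have /andP[+ _] := ceil_itv (100 / eps); rewrite intrB.
have : 1 <= 1 / eps by rewrite ler_pdivlMr //; lra.
rewrite -[101]/(100 + 1)%:R natrD mulrDl; lra.
Qed.

(** * Guarantees of the tester *)

Lemma tester_detects (R : realType) (n : nat) (eps : R) (f : boolfun n) :
  0 < eps -> eps <= 1 / 2 ->
  eps < dist_union_closed R f ->
  9 / 10 <= prob R f (union_closed_tester n eps) (pred1 FarFromUnionClosed).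
Proof.
move=> eps0 eps1.
pose w : R := Num.sqrt (2 * n%:R * ln (4 / eps)).
move=> /(@far_many_rejecting _ _ _ (n%:R / 2 - w) (n%:R / 2 + w)).
rewrite -/(middle n eps) => rej.
rewrite (prob_rounds _ _ _ _ (middle_neq0 n eps0 eps1)) /= mulr1 mulr0 addr0.
set p := #|rejecting f _|%:R / _; set m := absz _.
have n2 : 0 < 2 ^+ n :> R by rewrite exprn_gt0.
have M0 := card_middle_gt0 n eps0 eps1.
have M2 : #|middle n eps|%:R <= 2 ^+ n :> R.
  by rewrite -natrX ler_nat -card_cube max_card.
have p_ge : eps / 2 <= p.
  rewrite ler_pdivlMr //; have := card_middle_compl n eps0 eps1; nra.
have p_le : p <= 1.
  rewrite ler_pdivrMr // mul1r ler_nat subset_leq_card //.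
  by apply/fintype.subsetP => x; rewrite inE => /andP[].
have p0 : 0 <= p by lra.
(* Hence the tester misses with probability at most [1 / 51]. *)
have mp : 50 <= m%:R * p.
  have := rounds_ge eps0; rewrite -/m ler_pdivrMr //; nra.
have := bernoulli_inv m p0 p_le.
have : 0 <= (1 - p) ^+ m by rewrite exprn_ge0 // subr_ge0.
nra.
Qed.

Lemma tester_accepts (R : realType) (n : nat) (eps : R) (f : boolfun n) :
  0 < eps -> eps <= 1 / 2 ->
  union_closed f ->
  prob R f (union_closed_tester n eps) (pred1 UnionClosed) = 1.
Proof.
move=> eps0 eps1 /union_closed_rejecting fU.
rewrite (prob_rounds _ _ _ _ (middle_neq0 n eps0 eps1)) fU cards0 mul0r.
by rewrite subr0 expr1n subrr mul0r add0r mul1r.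
Qed.

Lemma tester_queries (R : realType) (n : nat) (eps : R) (f : boolfun n) :
  0 < eps -> eps <= 1 / 2 ->
  (2 <= n)%N ->
  (queries f (union_closed_tester n eps))%:R
    <= n%:R `^ (20 * Num.sqrt (n%:R * ln (1 / eps))) / eps.
Proof.
move=> eps0 eps1.
pose w : R := Num.sqrt (2 * n%:R * ln (4 / eps)).
move=> n2; have nR : 2 <= n%:R :> R by rewrite ler_nat.
(* Sizes of points of [M] differ by at most the width [2 * w]. *)
pose k := Num.truncn (2 * w).
have w0 : 0 <= w by exact: sqrtr_ge0.
have kw : k%:R <= 2 * w by rewrite truncn_le; lra.
have down x : x \in middle n eps -> (#|down_in (middle n eps) x| <= n.+1 ^ k)%N.
  move=> Mx; apply: card_down_in => y My.
  rewrite /k truncn_ge_nat; last lra.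
  move: Mx My; rewrite !mem_layers -/w => /andP[_ xw] /andP[wy _].
  have [xy|yx] := leqP #|x| #|y|; first by move/eqP: xy => ->; lra.
  by rewrite natrB 1?ltnW //; lra.
set s := Num.sqrt _.
have L1 : 1 / 2 <= ln (1 / eps).
  rewrite [1 / eps]div1r lnV ?posrE //.
  have : ln (1 + (eps - 1)) <= eps - 1 by apply: le_ln1Dx; lra.
  by rewrite addrC subrK; lra.
have s1 : 1 <= s.
  by rewrite -[leLHS]sqrtr1 ler_sqrt; nra.
(* Since [ln 4 = 2 * ln 2 <= 2 * ln (1 / eps)], the radicand of [w] is at most 6 times that of
   [s]. *)
have ws : w <= 3 * s.
  have e2 : 2 <= 1 / eps by rewrite ler_pdivlMr //; lra.
  have -> : 3 = Num.sqrt 9 :> R.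
    by rewrite -[9](_ : 3 ^+ 2 = _) ?sqrtr_sqr ?ger0_norm //; lra.
  rewrite -sqrtrM // ler_sqrt; last by rewrite !mulr_ge0 //; lra.
  have -> : ln (4 / eps) = ln (2 ^+ 2) + ln (1 / eps).
    rewrite -lnM ?posrE ?divr_gt0 ?exprn_gt0 //; congr ln.
    by field; rewrite gt_eqF.
  have l2 : ln 2 <= ln (1 / eps) by rewrite ler_ln ?posrE ?divr_gt0.
  rewrite lnXn // mulr2n; nra.
have n0 : 0 <= n%:R :> R by [].
have n1 : 1 <= n%:R :> R by lra.
have nn0 : n%:R != 0 :> R by rewrite gt_eqF //; lra.
have ws20 : 8 + 4 * w <= 20 * s by lra.
(* For [n >= 2], [n + 1 <= n ^ 2] turns [n.+1 ^ k] into a power of [n] with exponent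
   [2 * k <= 4 * w]. *)
have dn : (n.+1 ^ k).+1%:R <= 2 * n%:R `^ (4 * w) :> R.
  have : n.+1%:R ^+ k <= n%:R `^ (4 * w) :> R.
    apply: (@le_trans _ _ (n%:R `^ (2 * k%:R))); last first.
      by rewrite ler_powR //; lra.
    rewrite powRrM powR_mulrn ?powR_ge0 // (powR_mulrn 2) //.
    by rewrite lerXn2r ?nnegrE ?exprn_ge0 // -natr1; nra.
  have : 1 <= n%:R `^ (4 * w) :> R.
    by rewrite -[leLHS](powRr0 n%:R) ler_powR //; lra.
  have -> : (n.+1 ^ k).+1%:R = n.+1%:R ^+ k + 1 :> R by rewrite -natrX natr1.
  by move: (n.+1%:R ^+ k) (n%:R `^ (4 * w)) => u v; lra.
have m_le := rounds_le eps0 eps1; set m := absz _ in m_le.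
apply: (@le_trans _ _ (m%:R * (n.+1 ^ k).+1%:R)).
  by rewrite -natrM ler_nat; apply: queries_rounds.
apply: (@le_trans _ _ (101 / eps * (2 * n%:R `^ (4 * w)))).
  by rewrite ler_pM.
(* 101 * 2 <= 2^8 <= n^8, and 8 + 4 w <= 20 s because w <= 3 s and 1 <= s. *)
have n8 : 2 ^+ 8 <= n%:R `^ 8 :> R by rewrite powR_mulrn // lerXn2r ?nnegrE.
have n20 : n%:R `^ 8 * n%:R `^ (4 * w) <= n%:R `^ (20 * s) :> R.
  by rewrite -powRD ?nn0 ?implybT // ler_powR.
rewrite mulrAC ler_wpM2r ?invr_ge0 ?(ltW eps0) //; apply: le_trans n20.
rewrite mulrA ler_wpM2r ?powR_ge0 //; apply: le_trans n8; clear; lra.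
Qed.

Theorem theorem5p6 (R : realType) :
  exists C : R, 0 < C /\
    forall (n : nat) (eps : R) (f : boolfun n), 0 < eps -> eps <= 1 / 2 ->
      [/\ (2 <= n)%N ->
            (queries f (union_closed_tester n eps))%:R
              <= n%:R `^ (C * Num.sqrt (n%:R * ln (1 / eps))) / eps,
          union_closed f ->
            prob R f (union_closed_tester n eps) (pred1 UnionClosed) = 1
        & eps < dist_union_closed R f ->
            9 / 10 <= prob R f (union_closed_tester n eps)
                        (pred1 FarFromUnionClosed)].
Proof.
exists 20; split=> // n eps f eps0 eps1; split.
- exact: tester_queries.
- exact: tester_accepts.
- exact: tester_detects.
Qed.
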